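(* The greedy random walk on $\mathbb{Z}^2$ with rule $\mathcal{R}_{\mathrm{RAND}}$, started at the origin, returns to the origin infinitely often almost surely if and only if, in the planar mirror model on $\mathbb{Z}^2$, almost surely every orbit is periodic.
   Context: A greedy random walk (GRW) on a connected locally finite graph $G=(V,E)$ started at $v_0$: $X_0=v_0$; with $H_t=\{\{X_{s-1},X_s\}:0<s\le t\}$ and $J_t(v)=\{e\in E: v\in e, e\notin H_t\}$, if $J_t(X_t)\ne\emptyset$ then $X_{t+1}$ is chosen by the rule $\mathcal{R}_{\mathrm{RAND}}$: uniformly at random among the endpoints (other than $X_t$) of the edges in $J_t(X_t)$; if $J_t(X_t)=\emptyset$ then $X_{t+1}$ is a uniformly random neighbor of $X_t$. Planar mirror model: independently at each vertex of $\mathbb{Z}^2$, place a two-sided mirror along one of the two diagonal directions (each with probability $1/3$), or no mirror (probability $1/3$). A particle moves along the edges of $\mathbb{Z}^2$ one unit per step; at a vertex with no mirror it continues straight, and at a vertex with a mirror it is deflected by the law of reflection. An orbit (trajectory of a particle started at some vertex in some direction) is periodic if the particle eventually returns to its starting vertex moving in its starting direction. *)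

(* Defs.v *)
(* Probabilities are rationals; all events considered are
   finite-horizon events, whose probabilities are finite sums. *)
From HB Require Import structures.
From mathcomp Require Import all_boot all_order all_algebra.
Set Implicit Arguments. Unset Strict Implicit. Unset Printing Implicit Defensive.
Import Order.TTheory GRing.Theory Num.Theory.
Local Open Scope ring_scope.

Definition pt := (int * int)%type.
Definition origin : pt := (0, 0).
Definition dirs : seq pt := [:: (1, 0); (-1, 0); (0, 1); (0, -1)].
Definition padd (p q : pt) : pt := (p.1 + q.1, p.2 + q.2).
Definition nbrs (x : pt) : seq pt := [seq padd x d | d <- dirs].

Definition conv_to_one (u : nat -> rat) : Prop :=
  forall eps : rat, 0 < eps -> exists T0 : nat, forall T : nat, (T0 <= T)%N -> 1 - eps < u T.

(* A history h = [:: X_0; X_1; ...; X_t]. *)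
Definition grw_used (h : seq pt) : seq (pt * pt) := zip h (behead h).
Definition grw_unused (h : seq pt) (x y : pt) : bool :=
  ((x, y) \notin grw_used h) && ((y, x) \notin grw_used h).
Definition grw_choices (h : seq pt) : seq pt :=
  let x := last origin h in
  let c := [seq y <- nbrs x | grw_unused h x y] in
  if c is [::] then nbrs x else c.
Fixpoint grw_prob (T : nat) (h : seq pt) (ev : seq pt -> bool) : rat :=
  if T is T'.+1 then
    let c := grw_choices h in
    \sum_(y <- c) (size c)%:R^-1 * grw_prob T' (rcons h y) ev
  else (ev h)%:R.
Definition at_least_returns (N : nat) (h : seq pt) : bool :=
  (N <= count (pred1 origin) (behead h))%N.
Definition grw_ret_prob (N T : nat) : rat :=
  grw_prob T [:: origin] (at_least_returns N).

(* mirror at a vertex: 0 = none, 1 = mirror along y = x, 2 = along y = -x *)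
Definition reflect_dir (m : 'I_3) (d : pt) : pt :=
  match val m with
  | 0%N => d
  | 1%N => (d.2, d.1)
  | _ => (- d.2, - d.1)
  end.
(* state (p, d): particle at p about to move in direction d *)
Definition mstep (cfg : pt -> 'I_3) (s : pt * pt) : pt * pt :=
  let q := padd s.1 s.2 in (q, reflect_dir (cfg q) s.2).
Definition returns_by (cfg : pt -> 'I_3) (s : pt * pt) (T : nat) : bool :=
  has (fun t => iter t (mstep cfg) s == s) (iota 1 T).
Definition box_cfg (v : pt) (T : nat)
    (f : {ffun 'I_(T.*2).+1 * 'I_(T.*2).+1 -> 'I_3}) (q : pt) : 'I_3 :=
  if ((absz (q.1 - v.1) <= T) && (absz (q.2 - v.2) <= T))%N then
    f (inord (absz (q.1 - v.1 + T%:Z)), inord (absz (q.2 - v.2 + T%:Z)))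
  else ord0.
(* P(the orbit of (v,d) returns to (v,d) within T steps), mirrors i.i.d.
   uniform on the three options (only mirrors within distance T matter) *)
Definition mirror_ret_prob (v d : pt) (T : nat) : rat :=
  \sum_(f : {ffun 'I_(T.*2).+1 * 'I_(T.*2).+1 -> 'I_3})
     (3%:R^-1) ^+ (((T.*2).+1) ^ 2)%N * (returns_by (box_cfg v f) (v, d) T)%:R.

(* Main.v *)
Require Import Defs.
From HB Require Import structures.
From mathcomp Require Import all_boot all_order all_algebra.
From mathcomp Require Import zify ring lra.
Set Implicit Arguments. Unset Strict Implicit. Unset Printing Implicit Defensive.
Import Order.TTheory GRing.Theory Num.Theory.
Local Open Scope ring_scope.

(** When every vertex has an even number of used edges, the greedy walk leaves
    its position [w] along an unused edge, if there is one, and cannot get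
    stuck before it is back at [w]. On the way, at a fresh vertex it goes
    straight, left or right with probability 1/3 each; at a vertex crossed once
    its only way out is the remaining edge. Hence such an excursion is a piece
    of orbit in the mirror model, conditioned on finitely many mirrors.

    If the walk is recurrent, then the four orbits leaving the origin almost
    surely come back to it; the dynamics being injective, they are periodic. If
    all orbits are periodic, then all excursions are almost surely finite, and
    the steps made between excursions form a simple random walk on the plane,
    which is recurrent by Polya's theorem. *)

(** * Recurrence of the simple random walk on the plane *)

(** Probability that simple random walk from [x] visits the origin at least [n] times at times 1 to
    [k]; truncated subtraction makes [n = 0] absorbing. *)
Fixpoint srw_visits (k n : nat) (x : pt) : rat :=
  if k is k'.+1 then
    4%:R^-1 * \sum_(y <- nbrs x) srw_visits k' (n - (y == origin)) y
  else (n == 0)%:R.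

(** Truncated Green function: the expected number of visits to the origin at times 1 to [k], time 0
    excluded. *)
Fixpoint srw_green (k : nat) (x : pt) : rat :=
  if k is k'.+1 then
    4%:R^-1 * \sum_(y <- nbrs x) ((y == origin)%:R + srw_green k' y)
  else 0.

Fixpoint srw_at (k : nat) (x : pt) : rat :=
  if k is k'.+1 then 4%:R^-1 * \sum_(y <- nbrs x) srw_at k' y
  else (x == origin)%:R.

Fixpoint line_at (k : nat) (z : int) : rat :=
  if k is k'.+1 then 2%:R^-1 * (line_at k' (z + 1) + line_at k' (z - 1))
  else (z == 0)%:R.

Lemma big_nbrs (x : pt) (F : pt -> rat) :
  \sum_(y <- nbrs x) F y =
  F (x.1 + 1, x.2) + F (x.1 - 1, x.2) + F (x.1, x.2 + 1) + F (x.1, x.2 - 1).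
Proof. by rewrite /nbrs !big_cons big_nil /padd /= !addr0 !addrA. Qed.

Lemma srw_visits0 k x : srw_visits k 0 x = 1.
Proof.
elim: k x => [|k IH] x //=.
by rewrite big_nbrs !sub0n !IH; field.
Qed.

Lemma srw_visits_ge0 k n x : 0 <= srw_visits k n x.
Proof.
elim: k n x => [|k IH] n x /=; first exact: ler0n.
by rewrite mulr_ge0 ?invr_ge0 ?ler0n ?sumr_ge0.
Qed.

Lemma ler_nbrs_avg (x : pt) (F G : pt -> rat) :
  (forall y, F y <= G y) ->
  4%:R^-1 * \sum_(y <- nbrs x) F y <= 4%:R^-1 * \sum_(y <- nbrs x) G y.
Proof. by move=> FG; rewrite ler_wpM2l ?invr_ge0 ?ler0n // ler_sum. Qed.

Lemma srw_visitsS k n x : srw_visits k n x <= srw_visits k.+1 n x.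
Proof.
elim: k n x => [|k IH] n x; last by apply: ler_nbrs_avg => y; apply: IH.
case: n => [|n]; first by rewrite !srw_visits0.
exact: srw_visits_ge0.
Qed.

Lemma srw_visits_mono k l n x :
  (k <= l)%N -> srw_visits k n x <= srw_visits l n x.
Proof.
move=> /subnK <-; elim: (l - k)%N => // m IH.
exact: le_trans IH (srw_visitsS _ _ _).
Qed.

Lemma srw_green_ge0 k x : 0 <= srw_green k x.
Proof.
elim: k x => [|k IH] x //=.
by rewrite mulr_ge0 ?invr_ge0 ?ler0n ?sumr_ge0 // => y _; rewrite addr_ge0 ?ler0n.
Qed.

Lemma srw_greenS k x : srw_green k x <= srw_green k.+1 x.
Proof.
elim: k x => [|k IH] x; first exact: srw_green_ge0.
by apply: ler_nbrs_avg => y; rewrite lerD2l.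
Qed.

(* First-return decomposition of the expected number of visits. *)
Lemma srw_green_le k x :
  srw_green k x <= srw_visits k 1 x * (1 + srw_green k origin).
Proof.
elim: k x => [|k IH] x; first by rewrite /= mul0r.
apply: (@le_trans _ _ (srw_visits k.+1 1 x * (1 + srw_green k origin))); last first.
  by rewrite ler_wpM2l ?srw_visits_ge0 // lerD2l srw_greenS.
rewrite /= -mulrA mulr_suml; apply: ler_nbrs_avg => y.
case: eqP => [->|_]; first by rewrite srw_visits0 mul1r.
by rewrite add0r subn0.
Qed.

(** Markov property at the first visit: at least [l] steps remain after it, and monotonicity in the
    number of steps absorbs the surplus. *)
Lemma srw_visits_mulS k l n x :
  srw_visits k 1 x * srw_visits l n origin <= srw_visits (k + l) n.+1 x.
Proof.
elim: k x => [|k IH] x; first by rewrite /= mul0r srw_visits_ge0.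
rewrite addSn /= -mulrA mulr_suml; apply: ler_nbrs_avg => y.
case: eqP => [->|_].
  by rewrite subnn srw_visits0 mul1r subn1 srw_visits_mono // leq_addl.
by rewrite !subn0.
Qed.

Lemma srw_visits_exp k n :
  srw_visits k 1 origin ^+ n <= srw_visits (n * k) n origin.
Proof.
elim: n => [|n IH]; first by rewrite srw_visits0.
rewrite exprS mulSn; apply: le_trans (srw_visits_mulS _ _ _ _).
by rewrite ler_wpM2l // srw_visits_ge0.
Qed.

Lemma srw_greenE k x : srw_green k x = \sum_(j < k) srw_at j.+1 x.
Proof.
elim: k x => [|k IH] x; first by rewrite big_ord0.
rewrite big_ord_recl /= -mulr_sumr -mulrDr exchange_big /= -big_split /=.
by congr (_ * _); apply: eq_bigr => y _; rewrite IH.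
Qed.

(* In the coordinates x1 + x2, x1 - x2 the planar walk is a pair of
   independent walks on the line. *)
Lemma srw_atE k x : srw_at k x = line_at k (x.1 + x.2) * line_at k (x.1 - x.2).
Proof.
elim: k x => [|k IH] [a b] /=.
  rewrite -natrM mulnb; congr (_%:R); congr nat_of_bool.
  rewrite /origin xpair_eqE; lia.
rewrite big_nbrs !IH /=.
have -> : a + 1 + b = a + b + 1 by ring.
have -> : a + 1 - b = a - b + 1 by ring.
have -> : a - 1 + b = a + b - 1 by ring.
have -> : a - 1 - b = a - b - 1 by ring.
have -> : a + (b + 1) = a + b + 1 by ring.
have -> : a - (b + 1) = a - b - 1 by ring.
have -> : a + (b - 1) = a + b - 1 by ring.
have -> : a - (b - 1) = a - b + 1 by ring.
by field.
Qed.

Lemma line_at_ge0 k z : 0 <= line_at k z.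
Proof.
elim: k z => [|k IH] z /=; first exact: ler0n.
by rewrite mulr_ge0 ?addr_ge0.
Qed.

(** Going from [2i - k] to 0 in [k] steps takes exactly [i] steps down, and Pascal's rule matches
    the recursion of the walk. *)
Lemma line_at_ge_bin k i :
  'C(k, i)%:R / 2%:R ^+ k <= line_at k (i%:Z *+ 2 - k%:Z).
Proof.
elim: k i => [|k IH] [|i] /=.
- by rewrite bin0 expr0 divr1.
- by rewrite bin0n mul0r ler0n.
- have -> : 0%:Z *+ 2 - k.+1%:Z + 1 = 0%:Z *+ 2 - k%:Z by lia.
  rewrite bin0 exprS invfM mulrCA ler_wpM2l ?invr_ge0 ?ler0n //.
  have := IH 0%N; rewrite bin0 => IH0; apply: le_trans IH0 _.
  by rewrite lerDl line_at_ge0.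
- have -> : i.+1%:Z *+ 2 - k.+1%:Z + 1 = i.+1%:Z *+ 2 - k%:Z by lia.
  have -> : i.+1%:Z *+ 2 - k.+1%:Z - 1 = i%:Z *+ 2 - k%:Z by lia.
  rewrite binS natrD exprS invfM mulrCA ler_wpM2l ?invr_ge0 ?ler0n //.
  by rewrite mulrDl lerD.
Qed.

Lemma bin_doubleS n :
  ('C(n.+1.*2, n.+1) * n.+1 = 'C(n.*2, n) * (n.*2.+1).*2)%N.
Proof.
have h1 : (n.+1.*2 * 'C(n.*2.+1, n) = n.+1 * 'C(n.+1.*2, n.+1))%N.
  by rewrite doubleS mul_bin_diag.
have h2 : (n.*2.+1 * 'C(n.*2, n) = n.+1 * 'C(n.*2.+1, n))%N.
  rewrite mul_bin_down; congr (_ * _)%N; rewrite -addnn; lia.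
rewrite -!muln2 in h1 h2 *; nia.
Qed.

(** From [m] to [m + 1] the square is multiplied by [((2m+1)/(2m+2))^2], which exceeds [m/(m+1)]
    because [(2m+1)^2 > 4m(m+1)]. This avoids Stirling's formula. *)
Lemma central_bin_sqr_ge n :
  (4 * n.+1)%:R^-1 <= ('C(n.+1.*2, n.+1)%:R / 2%:R ^+ n.+1.*2) ^+ 2 :> rat.
Proof.
elim: n => [|n IH]; first by vm_compute.
have := bin_doubleS n.+1 => /(congr1 (fun k => k%:R : rat)).
set c := 'C(n.+2.*2, _); set b := 'C(n.+1.*2, _) in IH *.
rewrite !natrM => E.
set m : rat := n.+1%:R.
have m0 : 0 < m by rewrite ltr0n.
have E' : c%:R = b%:R * (2 * (2 * m + 1)) / (m + 1) :> rat.
  apply/eqP; rewrite eq_sym -subr_eq0; apply/eqP.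
  have -> : b%:R * (2 * (2 * m + 1)) = c%:R * (m + 1) :> rat.
    have -> : m + 1 = n.+2%:R by rewrite /m -[n.+2]addn1 natrD.
    rewrite E; have -> : (n.+1.*2.+1).*2 = (2 * (2 * n.+1 + 1))%N by lia.
    by rewrite natrM natrD natrM.
  by rewrite mulfK ?subrr // lt0r_neq0 // ltr_wpDl ?ltW.
rewrite E' -[n.+2]addn1 natrD -/m doubleD exprD.
move: IH; rewrite natrM -/m; set q := 2%:R ^+ _ : rat => IH.
have -> : (b%:R * (2 * (2 * m + 1)) / (m + 1) / (q * 2%:R ^+ 1.*2)) =
   (b%:R / q) * ((2 * m + 1) / (2 * m + 2)).
  have q0 : q != 0 by rewrite expf_neq0.
  field; rewrite q0 /=; lra.
rewrite exprMn.
apply: le_trans (_ : (4 * m)^-1 * ((2 * m + 1) / (2 * m + 2)) ^+ 2 <= _); last first.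
  by rewrite ler_wpM2r // sqr_ge0.
have -> : (4 * m)^-1 * ((2 * m + 1) / (2 * m + 2)) ^+ 2 =
  (4 * (m + 1))^-1 + (16%:R * m * (m + 1) ^+ 2)^-1.
  by field; lra.
rewrite lerDl invr_ge0; apply: mulr_ge0; [lra | exact: sqr_ge0].
Qed.

(** Oresme's argument: each dyadic block of terms contributes at least 1/2. *)
Lemma harmonic_ge m : m%:R / 2%:R <= \sum_(j < 2 ^ m) (j.+1)%:R^-1 :> rat.
Proof.
elim: m => [|m IH]; first by rewrite mul0r sumr_ge0 // => i _; rewrite invr_ge0.
rewrite expnS mul2n -addnn big_split_ord /= -natr1 mulrDl lerD //.
apply: le_trans (_ : \sum_(i < 2 ^ m) (2 ^ m.+1)%:R^-1 <= _).
  rewrite sumr_const card_ord -[X in _ <= X]mulr_natr expnS natrM invfM mul1r -mulrA.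
  by rewrite mulVf ?mulr1 // pnatr_eq0 -lt0n expn_gt0.
apply: ler_sum => i _; rewrite lef_pV2 ?posrE ?ltr0n ?expn_gt0 //.
by rewrite ler_nat expnS; have := ltn_ord i; lia.
Qed.

Lemma srw_at_ge0 k x : 0 <= srw_at k x.
Proof. by rewrite srw_atE mulr_ge0 ?line_at_ge0. Qed.

Lemma srw_at_double_ge n : (4 * n.+1)%:R^-1 <= srw_at n.+1.*2 origin.
Proof.
rewrite srw_atE -[origin.1 + _]/(0 : int) -expr2.
apply: le_trans (central_bin_sqr_ge n) _.
have := line_at_ge_bin n.+1.*2 n.+1.
have -> : n.+1%:Z *+ 2 - n.+1.*2%:Z = 0 by lia.
by move=> h; rewrite lerXn2r ?nnegrE ?line_at_ge0 // divr_ge0 ?exprn_ge0.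
Qed.

Lemma srw_green_ge n :
  \sum_(j < n) (4 * j.+1)%:R^-1 <= srw_green n.*2 origin.
Proof.
rewrite srw_greenE; elim: n => [|n IH]; first by rewrite !big_ord0.
rewrite doubleS !big_ord_recr -[X in _ <= X]addrA; apply: lerD => //.
by apply: le_trans (srw_at_double_ge n) _; rewrite lerDr; apply: srw_at_ge0.
Qed.

Lemma srw_green_unbounded (B : rat) : exists k, B < srw_green k origin.
Proof.
(* The harmonic bound loses a factor 2 and the return probabilities a factor 4, hence 8; the
   doubling is there because only even times are counted. *)
exists (2 ^ (8 * Num.bound B)).*2.
apply: lt_le_trans (srw_green_ge _).
under eq_bigr do rewrite natrM invfM.
rewrite -mulr_sumr; apply: lt_le_trans (_ : (Num.bound B)%:R <= _).
  apply: le_lt_trans (ler_norm _) _.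
  by have := archi_boundP (normr_ge0 B); rewrite /Num.bound normr_id.
apply: le_trans (_ : 4%:R^-1 * ((8 * Num.bound B)%:R / 2%:R) <= _); last first.
  by rewrite ler_wpM2l // harmonic_ge.
by rewrite natrM; lra.
Qed.

(** With [g] the Green function at the origin and [p] the return probability, [g <= p (1 + g)]; so
    [p >= 1 - 1/(1+g)], and [g] is unbounded. *)
Lemma srw_visits1_lim (eps : rat) :
  0 < eps -> exists k, 1 - eps < srw_visits k 1 origin.
Proof.
move=> e0; have [k hk] := srw_green_unbounded eps^-1; exists k.
have := srw_green_le k origin; set g := srw_green k origin in hk *.
set p := srw_visits _ _ _ => h.
have g0 : 0 < g by apply: lt_trans hk; rewrite invr_gt0.
have : 1 < eps * g by rewrite -ltr_pdivrMl ?mulr1 //.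
by move=> h1; rewrite ltNge; apply/negP => h2; nra.
Qed.

Lemma bernoulli_ge (e : rat) n : e <= 1 -> 1 - n%:R * e <= (1 - e) ^+ n.
Proof.
move=> e1; elim: n => [|n IH]; first by rewrite mul0r subr0.
have : 0 <= (1 - e) * ((1 - e) ^+ n - (1 - n%:R * e)).
  by rewrite mulr_ge0 // subr_ge0.
have : 0 <= n%:R * e ^+ 2 by rewrite mulr_ge0 ?sqr_ge0.
by move=> h1 h2; rewrite exprS -natr1; lra.
Qed.

Lemma polya_srw_visits n (eps : rat) :
  0 < eps -> exists k, 1 - eps < srw_visits k n origin.
Proof.
(* The minimum with 1 keeps [1 - e] nonnegative for Bernoulli's inequality; dividing by [n + 1]
   makes the total loss [n * e] strictly less than [eps]. *)
move=> e0; pose e : rat := Num.min 1 (eps / n.+1%:R).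
have e1 : 0 < e by rewrite lt_min ltr01 divr_gt0.
have [k hk] := srw_visits1_lim e1; exists (n * k)%N.
apply: lt_le_trans (srw_visits_exp k n).
apply: lt_le_trans (_ : (1 - e) ^+ n <= _); last first.
  rewrite lerXn2r ?nnegrE ?srw_visits_ge0 ?(ltW hk) // subr_ge0.
  by rewrite ge_min lexx.
apply: lt_le_trans (_ : 1 - n%:R * e <= _).
  rewrite ltrD2l ltrN2; apply: le_lt_trans (_ : n%:R * (eps / n.+1%:R) < _).
    by rewrite ler_wpM2l // ge_min lexx orbT.
  by rewrite mulrCA gtr_pMr // ltr_pdivrMr ?ltr0n // mul1r ltr_nat.
by apply: bernoulli_ge; rewrite ge_min lexx.
Qed.

(** * The mirror model *)

Definition pcfg := pt -> option 'I_3.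

Definition no_mirror_seen : pcfg := fun=> None.

Definition upd (c : pcfg) (p : pt) (m : 'I_3) : pcfg :=
  fun q => if q == p then Some m else c q.

(* Probability that the particle hits [w] within [T] steps when mirrors are
   revealed only as they are met; [c] records those already revealed. *)
Fixpoint mirror_hit (w : pt) (T : nat) (c : pcfg) (s : pt * pt) : rat :=
  if T is T'.+1 then
    let q := padd s.1 s.2 in
    if q == w then 1 else
    if c q is Some m then mirror_hit w T' c (q, reflect_dir m s.2)
    else 3%:R^-1 * \sum_(m < 3) mirror_hit w T' (upd c q m) (q, reflect_dir m s.2)
  else 0.

Lemma eq_mirror_hit w T c c' s :
  c =1 c' -> mirror_hit w T c s = mirror_hit w T c' s.
Proof.
elim: T c c' s => [|T IH] c c' s cc' //=.
rewrite -cc'; case: ifP => // _; case: (c _) => [m|]; first exact: IH.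
congr (_ * _); apply: eq_bigr => m _; apply: IH => q.
by rewrite /upd; case: ifP.
Qed.

Lemma avg3_const (a : rat) : 3%:R^-1 * \sum_(m < 3) a = a.
Proof. by rewrite sumr_const card_ord -[a *+ 3]mulr_natl mulrA mulVf ?mul1r. Qed.

(** Deferred decisions: the mirror at [p] may be drawn in advance instead of on arrival. If another
    fresh vertex is met first, the two independent draws commute. *)
Lemma mirror_hit_defer w T c s p : c p = None ->
  mirror_hit w T c s = 3%:R^-1 * \sum_(m < 3) mirror_hit w T (upd c p m) s.
Proof.
elim: T c s => [|T IH] c s cp; first by rewrite /= big1 ?mulr0.
rewrite /=; set q := padd _ _; case: eqP => [_|_]; first by rewrite avg3_const.
have [qp|qp] := eqVneq q p.
  rewrite qp cp; congr (_ * _); apply: eq_bigr => m _.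
  by rewrite {2}/upd eqxx.
have updq m : upd c p m q = c q by rewrite /upd (negbTE qp).
case cq : (c q) => [m'|].
  rewrite IH //; congr (_ * _); apply: eq_bigr => m _.
  by rewrite updq cq.
transitivity (3%:R^-1 * \sum_(m' < 3) (3%:R^-1 * \sum_(m < 3)
   mirror_hit w T (upd (upd c q m') p m) (q, reflect_dir m' s.2))).
  congr (_ * _); apply: eq_bigr => m' _; apply: IH.
  by rewrite /upd eq_sym (negbTE qp).
rewrite -mulr_sumr exchange_big mulr_sumr /=; congr (_ * _); apply: eq_bigr => m _.
rewrite updq cq; congr (_ * _); apply: eq_bigr => m' _.
apply: eq_mirror_hit => r; rewrite /upd.
by have [->|//] := eqVneq r p; rewrite eq_sym (negbTE qp).
Qed.

Lemma mirror_hit_ge0_le1 w T c s : 0 <= mirror_hit w T c s <= 1.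
Proof.
elim: T c s => [|T IH] c s /=; first by rewrite ?lexx ler01.
case: ifP => _; first by rewrite ?lexx ler01.
case: (c _) => [m|] //.
have {}IH m := IH (upd c (padd s.1 s.2) m) (padd s.1 s.2, reflect_dir m s.2).
rewrite mulr_ge0 ?sumr_ge0 //=; last by move=> m _; case/andP: (IH m).
rewrite -[X in _ <= X](avg3_const 1) ler_wpM2l // ler_sum // => m _.
by case/andP: (IH m).
Qed.

(* Prescribing finitely many mirrors is conditioning on an event of
   probability at least [3 ^ - size l]. *)
Lemma mirror_hit_condition w T s (l : seq pt) c :
  (forall q, q \notin l -> c q = None) ->
  1 - mirror_hit w T c s <= 3%:R ^+ size l * (1 - mirror_hit w T no_mirror_seen s).
Proof.
elim: l c => [|p l IH] c cl.
  by rewrite mul1r (@eq_mirror_hit _ _ c no_mirror_seen) // => q; rewrite cl.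
have le1 c' : 0 <= 1 - mirror_hit w T c' s.
  by rewrite subr_ge0; case/andP: (mirror_hit_ge0_le1 w T c' s).
(* Forget the mirror at [p]. The probability of missing [w] is then an average over three mirrors,
   one of which is the prescribed one: this costs a factor 3. *)
pose c' : pcfg := fun q => if q == p then None else c q.
have := IH c' => /(_ _) IH'.
have {}IH' : 1 - mirror_hit w T c' s <= 3%:R ^+ size l * (1 - mirror_hit w T no_mirror_seen s).
  apply: IH' => q ql; rewrite /c'; case: eqP => // /eqP qp.
  by rewrite cl // inE negb_or qp.
rewrite /= exprS -mulrA.
apply: le_trans (_ : 3%:R * (1 - mirror_hit w T c' s) <= _); last by rewrite ler_wpM2l.
case cp : (c p) => [m|]; last first.
  rewrite (@eq_mirror_hit _ _ c c'); first by rewrite ler_peMl.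
  by move=> q; rewrite /c'; case: eqP => // ->.
rewrite (@mirror_hit_defer _ _ c' _ p); last by rewrite /c' eqxx.
rewrite -[X in _ <= _ * (X - _)](avg3_const 1).
rewrite -mulrBr mulrA mulfV // mul1r -sumrB (bigD1 m) //=.
rewrite (@eq_mirror_hit _ _ c (upd c' p m)); last first.
  by move=> q; rewrite /upd /c'; case: eqP => // ->.
by rewrite lerDl sumr_ge0.
Qed.

(** * Drawing all the mirrors of a box at once *)

Fixpoint hits_by (cfg : pt -> 'I_3) (w : pt) (T : nat) (s : pt * pt) : bool :=
  if T is T'.+1 then
    (padd s.1 s.2 == w) || hits_by cfg w T' (mstep cfg s)
  else false.

Lemma eq_mstep cfg cfg' s : cfg =1 cfg' -> mstep cfg s = mstep cfg' s.
Proof. by move=> e; rewrite /mstep e. Qed.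

Lemma eq_hits_by cfg cfg' w T s :
  cfg =1 cfg' -> hits_by cfg w T s = hits_by cfg' w T s.
Proof. by move=> e; elim: T s => //= T IH s; rewrite (eq_mstep _ e) IH. Qed.

Definition ffupd (I : finType) (f : {ffun I -> 'I_3}) (i : I) (m : 'I_3) :=
  [ffun j => if j == i then m else f j].

(* [(m, f) |-> (f i, ffupd f i m)] is an involution. *)
Lemma sum_ffun_resample (I : finType) (i : I) (F : {ffun I -> 'I_3} -> rat) :
  \sum_f F f = 3%:R^-1 * \sum_(m < 3) \sum_f F (ffupd f i m).
Proof.
rewrite pair_bigA /=.
pose h (u : 'I_3 * {ffun I -> 'I_3}) := (u.2 i, ffupd u.2 i u.1).
have hK : involutive h.
  case=> m f; rewrite /h /= ffunE eqxx; congr (_, _); apply/ffunP => j.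
  by rewrite !ffunE; case: eqP => // ->.
rewrite (reindex_inj (inv_inj hK)) /= -[LHS](avg3_const) pair_bigA /=.
congr (_ * _); apply: eq_bigr => -[m f] _ /=; congr F.
by apply/ffunP => j; rewrite !ffunE; case: eqP => // ->.
Qed.

Lemma sum_ffun_weight (I : finType) (n : nat) : n = #|I| ->
  \sum_(f : {ffun I -> 'I_3}) (3%:R^-1 : rat) ^+ n = 1.
Proof.
move=> ->; rewrite sumr_const card_ffun card_ord -[X in X = _]mulr_natr natrX.
by rewrite -exprMn mulVf // expr1n.
Qed.

Definition overlay (c : pcfg) (cfg : pt -> 'I_3) (q : pt) : 'I_3 :=
  odflt (cfg q) (c q).

Definition dist (p q : pt) : nat := maxn (absz (p.1 - q.1)) (absz (p.2 - q.2)).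

Lemma dist_step (v p d : pt) (k : nat) :
  d \in dirs -> (dist p v <= k)%N -> (dist (padd p d) v <= k.+1)%N.
Proof.
case: v p => [a b] [x y]; rewrite /dist /padd !inE /=.
by case/or4P => /eqP -> /=; lia.
Qed.

Lemma reflect_dirs m d : d \in dirs -> reflect_dir m d \in dirs.
Proof.
by rewrite !inE; case/or4P => /eqP ->; case: m => [[|[|[|]]]] //.
Qed.

Lemma box_cfgE v B (f : {ffun 'I_(B.*2).+1 * 'I_(B.*2).+1 -> 'I_3}) q :
  (dist q v <= B)%N ->
  box_cfg v f q =
  f (inord (absz (q.1 - v.1 + B%:Z)), inord (absz (q.2 - v.2 + B%:Z))).
Proof. by rewrite geq_max /box_cfg => ->. Qed.

(** Distinct vertices of the box have distinct indices, [inord] being exact on shifted coordinates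
    between 0 and [2B]; so resampling one entry alters a single mirror. *)
Lemma box_cfg_ffupd v B (f : {ffun 'I_(B.*2).+1 * 'I_(B.*2).+1 -> 'I_3}) q m r :
  (dist q v <= B)%N ->
  box_cfg v (ffupd f (inord (absz (q.1 - v.1 + B%:Z)),
                      inord (absz (q.2 - v.2 + B%:Z))) m) r =
  if r == q then m else box_cfg v f r.
Proof.
move=> qB; have [->|rq] := eqVneq r q.
  by rewrite box_cfgE // ffunE eqxx.
have [rB|rB] := leqP (dist r v) B; last first.
  by rewrite /box_cfg -geq_max leqNgt rB.
rewrite !box_cfgE // ffunE; case: eqP => // -[/(congr1 val) h1 /(congr1 val) h2].
case/eqP: rq; move: qB rB h1 h2; rewrite /dist /= !geq_max => /andP[q1 q2] /andP[r1 r2].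
rewrite !inordK; [|lia..].
by case: r q v q1 q2 r1 r2 => [r1 r2] [q1 q2] [v1 v2] /=; move=> *; congr (_, _); lia.
Qed.

(** Revealing mirrors on arrival has the same law as drawing them all beforehand. The distance
    hypothesis keeps the particle in the box, so each fresh vertex owns an independent entry. *)
Lemma mirror_hit_box w v B T c s : s.2 \in dirs -> (dist s.1 v + T <= B)%N ->
  mirror_hit w T c s =
  \sum_(f : {ffun 'I_(B.*2).+1 * 'I_(B.*2).+1 -> 'I_3})
     3%:R^-1 ^+ ((B.*2).+1 ^ 2)%N * (hits_by (overlay c (box_cfg v f)) w T s)%:R.
Proof.
elim: T c s => [|T IH] c [p d] /= dd pB; first by rewrite big1 // => f _; rewrite mulr0.
have qB : (dist (padd p d) v + T <= B)%N.
  by have := dist_step dd (leqnn (dist p v)); lia.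
case: eqP => [_|_] /=.
  under eq_bigr do rewrite mulr1.
  by rewrite sum_ffun_weight // card_prod !card_ord mulnn.
case cq : (c _) => [m|].
  rewrite IH ?reflect_dirs //; apply: eq_bigr => f _.
  by rewrite /mstep /= /overlay cq.
(* Redraw the entry of the fresh vertex just reached; its value plays the role of the revealed
   mirror. *)
rewrite [RHS](sum_ffun_resample (inord (absz ((padd p d).1 - v.1 + B%:Z)),
   inord (absz ((padd p d).2 - v.2 + B%:Z)))).
congr (_ * _); apply: eq_bigr => m _; rewrite IH ?reflect_dirs //.
apply: eq_bigr => f _; congr (_ * (nat_of_bool _)%:R).
set g := ffupd _ _ _.
have gE : overlay (upd c (padd p d) m) (box_cfg v f) =1 overlay c (box_cfg v g).
  move=> r; rewrite /overlay /upd /g box_cfg_ffupd; last by lia.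
  by case: eqP => // ->; rewrite cq.
by rewrite (eq_hits_by _ _ _ gE) /mstep /= -gE /overlay /upd eqxx.
Qed.

Lemma mirror_hit_fresh_box w v B T d : d \in dirs -> (T <= B)%N ->
  mirror_hit w T no_mirror_seen (v, d) =
  \sum_(f : {ffun 'I_(B.*2).+1 * 'I_(B.*2).+1 -> 'I_3})
     3%:R^-1 ^+ ((B.*2).+1 ^ 2)%N * (hits_by (box_cfg v f) w T (v, d))%:R.
Proof.
move=> dd TB; rewrite (@mirror_hit_box w v B) //.
by rewrite /dist /= !subrr max0n.
Qed.

Lemma hits_byP cfg w T s :
  reflect (exists2 t, (0 < t <= T)%N & (iter t (mstep cfg) s).1 = w)
          (hits_by cfg w T s).
Proof.
elim: T s => [|T IH] s /=; first by constructor=> -[[|t]].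
apply: (iffP orP) => [[/eqP e|/IH [t tT e]]|[[|[|t]] // tT e]].
- by exists 1%N.
- by exists t.+1; [case/andP: tT | rewrite iterSr].
- by left; apply/eqP.
- by right; apply/IH; exists t.+1; rewrite // -iterSr.
Qed.

Lemma returns_byP cfg s T :
  reflect (exists2 t, (0 < t <= T)%N & iter t (mstep cfg) s = s)
          (returns_by cfg s T).
Proof.
apply: (iffP hasP) => [[t] | [t tT e]].
  by rewrite mem_iota add1n ltnS => tT /eqP e; exists t.
by exists t; [rewrite mem_iota add1n ltnS | apply/eqP].
Qed.

Lemma returns_by_hits cfg v d T : returns_by cfg (v, d) T -> hits_by cfg v T (v, d).
Proof. by case/returns_byP => t tT e; apply/hits_byP; exists t; rewrite ?e. Qed.

Lemma mirror_ret_prob_le_hit v d T : d \in dirs ->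
  mirror_ret_prob v d T <= mirror_hit v T no_mirror_seen (v, d).
Proof.
move=> dd; rewrite (@mirror_hit_fresh_box v v T) //; apply: ler_sum => f _.
rewrite ler_wpM2l ?exprn_ge0 ?invr_ge0 // ler_nat.
by case: (boolP (returns_by _ _ _)) => // /returns_by_hits ->.
Qed.

Lemma reflect_dirK m : involutive (reflect_dir m).
Proof. by case: m => [[|[|[|]]]] // ? [x y]; rewrite /reflect_dir /= ?opprK. Qed.

Lemma mstep_inj cfg : injective (mstep cfg).
Proof.
move=> [p d] [p' d']; rewrite /mstep /= => -[e1 e2 e3].
have e : padd p d = padd p' d' by rewrite /padd e1 e2.
move: e3; rewrite e => /(inv_inj (reflect_dirK _)) dd.
move: e1 e2; rewrite dd => /addIr e1 /addIr e2.
by case: p p' e1 e2 {e} => [? ?] [? ?] /= -> ->.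
Qed.

Lemma iter_mstep_dirs cfg s t :
  s.2 \in dirs -> (iter t (mstep cfg) s).2 \in dirs.
Proof. by move=> sd; elim: t => //= t IH; apply: reflect_dirs. Qed.

(* Five successive passages through [v] use at most four directions, and the
   dynamics is injective. *)
Lemma hits_returns_by cfg v d T B : d \in dirs -> (4 * T <= B)%N ->
  (forall e, e \in dirs -> hits_by cfg v T (v, e)) ->
  returns_by cfg (v, d) B.
Proof.
move=> dd TB hits.
(* [t i] is the time of an [i]-th passage through [v]; whatever the direction of departure, another
   passage follows within [T] steps. *)
have chain k : exists t : nat -> nat, forall i, (i <= k)%N ->
    [/\ (t i <= i * T)%N, (iter (t i) (mstep cfg) (v, d)).1 = v &
        forall j, (j < i)%N -> (t j < t i)%N].
  elim: k => [|k [t tP]]; first by exists (fun=> 0%N) => -[].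
  have [tk ek _] := tP k (leqnn k).
  have sk : iter (t k) (mstep cfg) (v, d) =
            (v, (iter (t k) (mstep cfg) (v, d)).2) by rewrite -{2}ek -surjective_pairing.
  have := hits _ (iter_mstep_dirs cfg (t k) (dd : (v, d).2 \in dirs)).
  case/hits_byP => u uT; rewrite -sk -iterD => eu.
  exists (fun i => if i == k.+1 then (u + t k)%N else t i) => i ik.
  have [->|ne] := eqVneq i k.+1.
    split=> //; first by rewrite mulSn leq_add // (andP uT).2.
    move=> j jk; rewrite (ltn_eqF jk); move: jk; rewrite ltnS leq_eqVlt.
    case/orP => [/eqP ->|jk]; first by lia.
    by have [_ _ /(_ j jk)] := tP k (leqnn k); lia.
  have ik' : (i <= k)%N by lia.
  have [h1 h2 h3] := tP i ik'; split=> // j ji.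
  by rewrite ltn_eqF ?h3 //; lia.
have [t tP] := chain 4%N.
pose D := [seq (iter (t i) (mstep cfg) (v, d)).2 | i <- iota 0 5].
have nuD : ~~ uniq D.
  apply/negP => uD; suff : (size D <= size dirs)%N by [].
  by apply: uniq_leq_size uD _ => e /mapP [i _ ->]; apply: iter_mstep_dirs.
have [i [j [ij j4 eij]]] : exists i j, [/\ (i < j)%N, (j <= 4)%N &
    (iter (t i) (mstep cfg) (v, d)).2 = (iter (t j) (mstep cfg) (v, d)).2].
  move/(uniqPn (0, 0)): nuD => [i [j [ij]]]; rewrite size_map size_iota => j5.
  have i5 : (i < 5)%N by lia.
  by rewrite !(nth_map 0%N) ?size_iota // !nth_iota // => e; exists i, j.
have [tj ej /(_ i ij) tij] := tP j j4.
have i4 : (i <= 4)%N by lia.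
have [_ ei _] := tP i i4.
apply/returns_byP; exists (t j - t i)%N.
  have : (j * T <= 4 * T)%N by rewrite leq_mul2r j4 orbT.
  by lia.
have : iter (t i) (mstep cfg) (iter (t j - t i) (mstep cfg) (v, d)) =
       iter (t i) (mstep cfg) (v, d).
  rewrite -iterD subnKC; last exact: ltnW.
  by rewrite [LHS]surjective_pairing [RHS]surjective_pairing ei ej eij.
move: (iter (t j - t i) _ _) => s; elim: (t i) => //= n IH /mstep_inj; exact: IH.
Qed.

(** Union bound: the orbit can fail to close up only if one of the four orbits leaving [v] misses
    [v]. *)
Lemma mirror_ret_prob_ge v d T B : d \in dirs -> (4 * T <= B)%N ->
  1 - \sum_(e <- dirs) (1 - mirror_hit v T no_mirror_seen (v, e))
    <= mirror_ret_prob v d B.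
Proof.
move=> dd TB4; have TB : (T <= B)%N by lia.
pose K : rat := 3%:R^-1 ^+ ((B.*2).+1 ^ 2)%N.
have K0 : 0 <= K by rewrite exprn_ge0 ?invr_ge0.
have sumK : \sum_(f : {ffun 'I_(B.*2).+1 * 'I_(B.*2).+1 -> 'I_3}) K = 1.
  by rewrite sum_ffun_weight // card_prod !card_ord mulnn.
pose miss (e : pt) (f : {ffun 'I_(B.*2).+1 * 'I_(B.*2).+1 -> 'I_3}) : rat :=
  (~~ hits_by (box_cfg v f) v T (v, e))%:R.
have missE e : e \in dirs ->
    1 - mirror_hit v T no_mirror_seen (v, e) = \sum_f K * miss e f.
  move=> ed; rewrite (@mirror_hit_fresh_box v v B) // -[X in X - _]sumK -sumrB.
  apply: eq_bigr => f _; rewrite /miss -/K.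
  by case: (hits_by _ _ _ _); rewrite ?mulr1 ?mulr0 ?subrr ?subr0.
rewrite (eq_big_seq _ missE) exchange_big /= -sumK -sumrB.
apply: ler_sum => f _; rewrite -/K -mulr_sumr -[X in X - _]mulr1 -mulrBr ler_wpM2l //.
have miss0 e : 0 <= miss e f by rewrite ler0n.
have [/allP h|/allPn [e ed ne]] := boolP (all (fun e => hits_by (box_cfg v f) v T (v, e)) dirs).
  by rewrite (hits_returns_by dd TB4 h) gerBl sumr_ge0.
apply: le_trans (_ : 0 <= _); last exact: ler0n.
rewrite subr_le0 (big_rem e ed) /= {1}/miss ne lerDl sumr_ge0 //.
Qed.

(** The box is centred at the starting vertex, so the same [f] encodes the translated
    configuration. *)
Lemma mirror_ret_prob_translate v d T :
  mirror_ret_prob v d T = mirror_ret_prob origin d T.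
Proof.
apply: eq_bigr => f _; congr (_ * (nat_of_bool _)%:R).
pose sh (s : pt * pt) := (padd v s.1, s.2).
have shS s : mstep (box_cfg v f) (sh s) = sh (mstep (box_cfg origin f) s).
  case: s => [[a b] [x y]]; rewrite /mstep /sh /padd /=.
  have -> : v.1 + a + x = v.1 + (a + x) by ring.
  have -> : v.2 + b + y = v.2 + (b + y) by ring.
  congr (_, reflect_dir _ _); rewrite /box_cfg /= !subr0.
  have -> : v.1 + (a + x) - v.1 = a + x by ring.
  by have -> : v.2 + (b + y) - v.2 = b + y by ring.
have -> : (v, d) = sh (origin, d).
  by case: v {shS} @sh => a b sh; rewrite /sh /padd /= !addr0.
have shI t : iter t (mstep (box_cfg v f)) (sh (origin, d)) =
             sh (iter t (mstep (box_cfg origin f)) (origin, d)).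
  by elim: t => //= t ->.
have sh_inj : injective sh.
  move=> [[a b] e] [[a' b'] e']; rewrite /sh /padd /=.
  by move=> [/addrI -> /addrI -> ->].
by apply: eq_has => t; rewrite shI (inj_eq sh_inj).
Qed.

(** * Excursions of the greedy walk *)

Definition popp (e : pt) : pt := (- e.1, - e.2).

Lemma padd_oppK p d : padd (padd p d) (popp d) = p.
Proof. by case: p => x y; rewrite /padd /= !addrK. Qed.

Lemma padd_inj p : injective (padd p).
Proof. by case: p => x y [a b] [a' b']; rewrite /padd /= => -[/addrI -> /addrI ->]. Qed.

Lemma padd_dir_neq p d : d \in dirs -> padd p d != p.
Proof.
case: p => x y; rewrite !inE.
by case/or4P => /eqP ->; rewrite /padd /= xpair_eqE; lia.
Qed.

Lemma popp_dirs d : d \in dirs -> popp d \in dirs.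
Proof. by rewrite !inE; case/or4P => /eqP ->. Qed.

Definition used (g : seq pt) (v e : pt) : bool := ~~ grw_unused g v (padd v e).

Lemma used_opp g v e : used g (padd v e) (popp e) = used g v e.
Proof. by rewrite /used /grw_unused padd_oppK andbC. Qed.

Lemma grw_used_rcons g y : g != [::] ->
  grw_used (rcons g y) = rcons (grw_used g) (last origin g, y).
Proof.
case: g => // x g _; rewrite /grw_used /=.
by elim: g x => //= z g IH x; rewrite IH.
Qed.

Lemma used_rcons g d v e : g != [::] ->
  used (rcons g (padd (last origin g) d)) v e =
  [|| used g v e, (v == last origin g) && (e == d)
    | (v == padd (last origin g) d) && (e == popp d)].
Proof.
move=> g0; rewrite /used /grw_unused grw_used_rcons // !mem_rcons !in_cons !negb_and !negbK.
set x := last origin g; rewrite !xpair_eqE.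
have -> : (v == x) && (padd v e == padd x d) = (v == x) && (e == d).
  by have [->|//] := eqVneq v x; rewrite (inj_eq (@padd_inj x)).
have -> : (padd v e == x) && (v == padd x d) = (v == padd x d) && (e == popp d).
  have [->|] := eqVneq v (padd x d); last by rewrite andbF.
  by rewrite andbT /= -{2}(padd_oppK x d) (inj_eq (@padd_inj _)).
by do 2!case: (_ \in grw_used g); rewrite /= ?orbT ?orbF.
Qed.

Lemma used_mem g v e : used g v e -> v \in g.
Proof.
rewrite /used /grw_unused negb_and !negbK /grw_used.
have mem_fst (a b : pt) (s t : seq pt) : (a, b) \in zip s t -> a \in s.
  elim: s t => [|x s IH] [|z t] //=; rewrite !in_cons xpair_eqE.
  by case/orP => [/andP[-> _] //|/IH ->]; rewrite orbT.
have mem_snd (a b : pt) (s t : seq pt) : (a, b) \in zip s t -> b \in t.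
  elim: s t => [|x s IH] [|z t] //=; rewrite !in_cons xpair_eqE.
  by case/orP => [/andP[_ ->] //|/IH ->]; rewrite orbT.
by case/orP => [/mem_fst //|/mem_snd /mem_behead].
Qed.

Lemma grw_choicesE g (x := last origin g) :
  grw_choices g =
  if [seq e <- dirs | ~~ used g x e] is [::] then nbrs x
  else [seq padd x e | e <- [seq e <- dirs | ~~ used g x e]].
Proof.
rewrite /grw_choices /nbrs filter_map -/x.
rewrite (@eq_filter _ (preim (padd x) (grw_unused g x)) (fun e => ~~ used g x e)).
  by case: [seq e <- dirs | ~~ used g x e].
by move=> e; rewrite /used negbK.
Qed.

(* The half-edges in [S] at a vertex are joined in pairs by the mirror [c];
   [None] means that the vertex is still untouched. *)
Definition paired (c : option 'I_3) (S : pt -> bool) : bool :=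
  if c is Some m then
    all (fun e => S (popp e) == S (reflect_dir m e)) dirs && has S dirs
  else ~~ has S dirs.

Definition odd_at (S : pt -> bool) : bool :=
  S (1, 0) (+) S (-1, 0) (+) S (0, 1) (+) S (0, -1).

Lemma eq_paired c S S' : S =1 S' -> paired c S = paired c S'.
Proof.
move=> e; rewrite /paired; case: c => [m|]; last by rewrite (eq_has e).
by rewrite (eq_has e); congr (_ && _); apply: eq_all => d; rewrite !e.
Qed.

Lemma eq_odd_at S S' : S =1 S' -> odd_at S = odd_at S'.
Proof. by move=> e; rewrite /odd_at !e. Qed.

Ltac split_on S :=
  repeat match goal with |- context [S ?x] => case: (S x) end.

Lemma paired_even c S : paired c S -> odd_at S = false.
Proof.
case: c => [[[|[|[|]]] //= i]|]; vm_compute; by split_on S.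
Qed.

(** A nonempty even set has two or four half-edges. Any two are joined by exactly one of the three
    mirrors; all four are compatible with each mirror. *)
Lemma even_paired S : odd_at S = false -> exists c, paired c S.
Proof.
move=> h; case: (boolP (has S dirs)) => hS; last by exists None.
suff [m mS] : exists m, paired (Some m) S by exists (Some m).
have [h1|h1] := boolP (S (1, 0) == S (-1, 0)).
  by exists ord0; move: h hS h1; vm_compute; split_on S.
have [h2|h2] := boolP (S (1, 0) == S (0, -1)).
  by exists (@Ordinal 3 1 isT); move: h hS h1 h2; vm_compute; split_on S.
by exists (@Ordinal 3 2 isT); move: h hS h1 h2; vm_compute; split_on S.
Qed.

(** [S] is a nonempty union of pairs of the mirror. Since the entering half-edge is not in it, [S]
    is the other pair, and the only exit is the partner of the entrance. *)
Lemma paired_forward m S d : d \in dirs -> paired (Some m) S -> ~~ S (popp d) ->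
  [seq e <- dirs | ~~ (S e || (e == popp d))] = [:: reflect_dir m d].
Proof.
rewrite !inE; case: m => [[|[|[|]]] //= i];
  case/or4P => /eqP ->; vm_compute; by split_on S.
Qed.

Lemma paired_add m c S d : d \in dirs -> paired c S -> ~~ S (popp d) ->
  (c = None \/ c = Some m) ->
  paired (Some m) (fun e => [|| S e, e == popp d | e == reflect_dir m d]).
Proof.
move=> dd cS nS cm; move: dd cS nS; case: cm => ->;
rewrite !inE; case: m => [[|[|[|]]] //= i];
  case/or4P => /eqP ->; vm_compute; by split_on S.
Qed.

(** At an untouched vertex the three exits other than a U-turn correspond one to one to the three
    mirrors: this is where the weights 1/3 of the two models meet. *)
Lemma fresh_choices S d (s := [seq e <- dirs | ~~ (S e || (e == popp d))]) :
  d \in dirs -> paired None S ->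
  [/\ size s = 3%N, forall e, e \in s -> exists m, e = reflect_dir m d &
      forall F : pt -> rat, \sum_(e <- s) F e = \sum_(m < 3) F (reflect_dir m d)].
Proof.
move=> dd; rewrite /paired => /hasPn hS.
have {s} -> : s = [seq e <- dirs | e != popp d].
  by apply: eq_in_filter => e /hS /negbTE ->.
have sumE (F : pt -> rat) : \sum_(m < 3) F (reflect_dir m d) =
    F d + F (d.2, d.1) + F (- d.2, - d.1).
  by rewrite !big_ord_recl big_ord0 addr0 addrA.
have memE e : e \in [:: d; (d.2, d.1); (- d.2, - d.1)] ->
    exists m, e = reflect_dir m d.
  rewrite !inE; case/or3P => /eqP ->; first by exists ord0.
    by exists (@Ordinal 3 1 isT).
  by exists (@Ordinal 3 2 isT).
have p : perm_eq [seq e <- dirs | e != popp d] [:: d; (d.2, d.1); (- d.2, - d.1)].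
  by move: dd; rewrite !inE; case/or4P => /eqP ->.
split; first by rewrite (perm_size p).
  by move=> e; rewrite (perm_mem p) => /memE.
by move=> F; rewrite (perm_big _ p) sumE /= !big_cons big_nil /= addr0 addrA.
Qed.

Definition udeg (g : seq pt) (v : pt) : nat := count (used g v) dirs.

(* The half-edge at the head of the last step is left out: it gets its
   partner only at the next step. *)
Definition half_used (g : seq pt) (q d v e : pt) : bool :=
  used g v e && ~~ ((v == q) && (e == popp d)).

(* [g] is on an excursion from [w], its last step going from [p] in direction
   [d]; [c] holds the mirrors forced by the used edges, and [n] is the number of
   edges used at [w] when the excursion began. *)
Definition on_excursion (w : pt) (n : nat) (g : seq pt) (c : pcfg) (p d : pt) :=
  [/\ [/\ g != [::], last origin g = padd p d, d \in dirs
        & used g (padd p d) (popp d)],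
      forall v, v != w -> paired (c v) (half_used g (padd p d) d v),
      odd_at (half_used g (padd p d) d w) & (n < udeg g w)%N].

Lemma leq_udeg_rcons g d v : g != [::] ->
  (udeg g v <= udeg (rcons g (padd (last origin g) d)) v)%N.
Proof. by move=> g0; apply: sub_count => e h; rewrite used_rcons // h. Qed.

Lemma used_half g q d v e : used g q (popp d) ->
  used g v e = half_used g q d v e || ((v == q) && (e == popp d)).
Proof.
rewrite /half_used => h; case: (boolP ((v == q) && _)); last by rewrite andbT orbF.
by case/andP => /eqP -> /eqP ->; rewrite h.
Qed.

(** The step completes a passage through [q]: the pending entrance is now counted together with the
    exit, and the far end of the new edge becomes pending. *)
Lemma half_used_rcons g q d e v e' : g != [::] -> last origin g = q ->
  used g q (popp d) -> e \in dirs -> ~~ used g q e ->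
  half_used (rcons g (padd q e)) (padd q e) e v e' =
  half_used g q d v e' || (v == q) && ((e' == popp d) || (e' == e)).
Proof.
move=> g0 gq uq ed nu; rewrite {1}/half_used -gq used_rcons // gq.
have [->|vq] := eqVneq v (padd q e).
  rewrite (negbTE (padd_dir_neq q ed)) /= orbF.
  have [->|ne] := eqVneq e' (popp e).
    by rewrite /half_used used_opp (negbTE nu) andbF.
  by rewrite /half_used (negbTE (padd_dir_neq q ed)) /= orbF andbT.
rewrite /= orbF andbT (used_half _ _ uq).
by case: (v == q); rewrite /= ?andbF ?orbF ?orbA.
Qed.

Lemma on_excursion_step w n g c c' p d e (q := padd p d) :
  on_excursion w n g c p d -> q != w -> e \in dirs -> ~~ used g q e ->
  (forall v, v != q -> c' v = c v) ->
  paired (c' q) (fun e' => [|| half_used g q d q e', e' == popp d | e' == e]) ->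
  on_excursion w n (rcons g (padd q e)) c' q e.
Proof.
move=> [[g0 gq dd uq] cP od nd] qw ed nu c'P c'q.
have hE := @half_used_rcons g q d e _ _ g0 gq uq ed nu.
split.
- split=> //; [by case: (g) | by rewrite last_rcons | rewrite /q -gq used_rcons //].
  by rewrite !eqxx !orbT.
- move=> v vw; rewrite (eq_paired _ (hE v)).
  have [->|vq] := eqVneq v q.
    by move: c'q; congr is_true; apply: eq_paired => e'; rewrite eqxx.
  rewrite c'P //; rewrite (@eq_paired _ _ (half_used g q d v)); first exact: cP.
  by move=> e'; rewrite orbF.
- rewrite (eq_odd_at (hE w)) (@eq_odd_at _ (half_used g q d w)) //.
  by move=> e'; rewrite eq_sym (negbTE qw) orbF.
- by apply: leq_trans nd _; rewrite /q -gq leq_udeg_rcons.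
Qed.

Lemma on_excursion_filter w n g c p d (q := padd p d) :
  on_excursion w n g c p d ->
  [seq e <- dirs | ~~ used g q e] =
  [seq e <- dirs | ~~ (half_used g q d q e || (e == popp d))].
Proof.
move=> [[g0 gq dd uq] _ _ _]; apply: eq_filter => e.
by rewrite (used_half _ _ uq) eqxx.
Qed.

Lemma half_used_head g q d : ~~ half_used g q d q (popp d).
Proof. by rewrite /half_used !eqxx andbF. Qed.

Lemma on_excursion_seen w n g c p d m (q := padd p d) :
  on_excursion w n g c p d -> q != w -> c q = Some m ->
  grw_choices g = [:: padd q (reflect_dir m d)] /\
  on_excursion w n (rcons g (padd q (reflect_dir m d))) c q (reflect_dir m d).
Proof.
move=> ex qw cq; have [[g0 gq dd uq] cP _ _] := ex.
have cPq := cP _ qw; rewrite -/q cq in cPq.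
have fE := paired_forward dd cPq (half_used_head g q d).
have fE' := on_excursion_filter ex.
rewrite -/q fE in fE'.
split; first by rewrite grw_choicesE gq -/q fE'.
have : reflect_dir m d \in [seq e <- dirs | ~~ used g q e] by rewrite fE' inE.
rewrite mem_filter => /andP [nu ed].
apply: on_excursion_step ex qw ed nu _ _ => //.
by rewrite cq; apply: (paired_add dd cPq (half_used_head g q d)); right.
Qed.

Lemma on_excursion_new w n g c p d (q := padd p d) :
  on_excursion w n g c p d -> q != w -> c q = None ->
  [/\ forall F, \sum_(y <- grw_choices g) (size (grw_choices g))%:R^-1 * F y =
        3%:R^-1 * \sum_(m < 3) F (padd q (reflect_dir m d)) :> rat,
      forall y, y \in grw_choices g -> exists m, y = padd q (reflect_dir m d) &
      forall m, on_excursion w n (rcons g (padd q (reflect_dir m d)))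
                  (upd c q m) q (reflect_dir m d)].
Proof.
move=> ex qw cq; have [[g0 gq dd uq] cP _ _] := ex.
have cPq := cP _ qw; rewrite -/q cq in cPq.
have [sz mem sumE] := fresh_choices dd cPq.
have fE := on_excursion_filter ex; rewrite -/q in fE; rewrite -fE in sz mem sumE.
have chE : grw_choices g = [seq padd q e | e <- [seq e <- dirs | ~~ used g q e]].
  by rewrite grw_choicesE gq -/q; case: [seq e <- dirs | ~~ used g q e] sz.
split.
- move=> F; rewrite chE size_map sz big_map -mulr_sumr.
  by rewrite (sumE (fun e => F (padd q e))).
- by move=> y; rewrite chE => /mapP [e /mem [m ->] ->]; exists m.
- move=> m.
  have : paired (Some m) (fun e => [|| half_used g q d q e, e == popp d | e == reflect_dir m d]).
    by apply: (paired_add dd cPq (half_used_head g q d)); left.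
  move=> pm; apply: on_excursion_step ex qw (reflect_dirs m dd) _ _ _.
  + rewrite -/q (used_half _ _ uq) eqxx /= negb_or; apply/andP; split.
      by move/hasPn: cPq; apply; apply: reflect_dirs.
    by case: m {pm} => [[|[|[|]]]] // i; move: dd; rewrite !inE; case/or4P => /eqP ->.
  + by move=> v vq; rewrite /upd (negbTE vq).
  + by rewrite /upd eqxx.
Qed.

Fixpoint grw_hit (w : pt) (T : nat) (g : seq pt) : rat :=
  if last origin g == w then 1 else
  if T is T'.+1 then
    \sum_(y <- grw_choices g) (size (grw_choices g))%:R^-1 * grw_hit w T' (rcons g y)
  else 0.

(** The time shift is due to [g] already containing the step from [p], which the particle in state
    [(p, d)] is still about to make. *)
Lemma grw_hit_mirror w n T g c p d : on_excursion w n g c p d ->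
  grw_hit w T g = mirror_hit w T.+1 c (p, d).
Proof.
elim: T g c p d => [|T IH] g c p d ex; have [[g0 gq dd uq] _ _ _] := ex.
  rewrite /= gq; case: ifP => // _; case: (c _) => // .
  by rewrite big1 ?mulr0.
rewrite [LHS]/= gq; rewrite [RHS]/=.
case: eqP => // /eqP qw; case cq : (c _) => [m|].
  have [-> ex'] := on_excursion_seen ex qw cq.
  by rewrite big_seq1 /= invr1 mul1r (IH _ _ _ _ ex').
have [-> _ ex'] := on_excursion_new ex qw cq.
by congr (_ * _); apply: eq_bigr => m _; rewrite (IH _ _ _ _ (ex' m)).
Qed.

Lemma on_excursion_next w n g c p d y :
  on_excursion w n g c p d -> padd p d != w -> y \in grw_choices g ->
  exists c' p' d', on_excursion w n (rcons g y) c' p' d'.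
Proof.
move=> ex qw; case cq : (c (padd p d)) => [m|].
  have [-> ex'] := on_excursion_seen ex qw cq.
  by rewrite inE => /eqP ->; exists c, (padd p d), (reflect_dir m d).
have [_ mem ex'] := on_excursion_new ex qw cq.
by move=> /mem [m ->]; eexists _, _, _; apply: ex'.
Qed.

Definition balanced (h : seq pt) : Prop :=
  h != [::] /\ forall v, odd_at (used h v) = false.

Lemma odd_at_add (S : pt -> bool) d : d \in dirs -> ~~ S d ->
  odd_at (fun e => S e || (e == d)) = ~~ odd_at S.
Proof. by rewrite !inE; case/or4P => /eqP ->; vm_compute; split_on S. Qed.

(** Arriving at [w] supplies the one half-edge that was left out, which restores even parity
    there. *)
Lemma on_excursion_end w n g c p d :
  on_excursion w n g c p d -> padd p d = w -> balanced g.
Proof.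
move=> [[g0 gq dd uq] cP od _] qw; split=> // v.
have uE := used_half _ _ uq.
have [->|vw] := eqVneq v w; last first.
  rewrite (@eq_odd_at _ (half_used g (padd p d) d v)); first exact: paired_even (cP v vw).
  by move=> e; rewrite uE qw (negbTE vw) orbF.
rewrite (@eq_odd_at _ (fun e => half_used g (padd p d) d w e || (e == popp d))); last first.
  by move=> e; rewrite uE qw eqxx.
rewrite odd_at_add ?od ?popp_dirs //.
by rewrite -qw half_used_head.
Qed.

(** Balance provides compatible mirrors at all touched vertices, and the first edge makes [w] odd.
    The control on where [c] is [None] bounds the number of prescribed mirrors. *)
Lemma excursion_start h d : balanced h -> d \in dirs -> ~~ used h (last origin h) d ->
  exists2 c, on_excursion (last origin h) (udeg h (last origin h))
               (rcons h (padd (last origin h) d)) c (last origin h) d &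
             forall v, ~~ has (used h v) dirs -> c v = None.
Proof.
move=> [h0 ev] dd nu; set w := last origin h in nu *.
have hE v e : half_used (rcons h (padd w d)) (padd w d) d v e =
              used h v e || (v == w) && (e == d).
  rewrite /half_used used_rcons // -/w.
  have [->|vq] := eqVneq v (padd w d); last by rewrite /= orbF andbT.
  rewrite (negbTE (padd_dir_neq w dd)) /= orbF.
  have [->|ne] := eqVneq e (popp d); last by rewrite orbF andbT.
  by rewrite used_opp (negbTE nu) andbF.
have [c cP] : exists c : pcfg, forall v, paired (c v) (used h v) /\
    (~~ has (used h v) dirs -> c v = None).
  (* When no mirror is compatible, parity forces the vertex to be untouched, and [None] is the right
     value. *)
  pose pick (v : pt) : option 'I_3 :=
    if [pick m | paired (Some m) (used h v)] is Some m then Some m else None.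
  exists pick => v; rewrite /pick; case: pickP => [m pm|no]; split=> //.
    by case/andP: (pm) => _ ->.
  have [[m|] // pm] := even_paired (ev v).
  by rewrite no in pm.
exists c; last by move=> v; case: (cP v).
split.
- split=> //; [by case: (h) | by rewrite last_rcons |].
  by rewrite used_rcons // -/w !eqxx !orbT.
- move=> v vw; rewrite (eq_paired _ (hE v)) (@eq_paired _ _ (used h v)); first by case: (cP v).
  by move=> e; rewrite (negbTE vw) orbF.
- rewrite (eq_odd_at (hE w)).
  rewrite (@eq_odd_at _ (fun e => used h w e || (e == d))); last by move=> e; rewrite eqxx.
  by rewrite odd_at_add // ev.
- have sub e : used h w e -> used (rcons h (padd w d)) w e.
    by move=> u; rewrite used_rcons // u.
  rewrite /udeg -!size_filter ltn_neqAle; apply/andP; split; last first.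
    by rewrite !size_filter sub_count.
  apply/eqP => eqs; move/negP: nu; apply.
  have : {subset [seq e <- dirs | used h w e] <= [seq e <- dirs | used (rcons h (padd w d)) w e]}.
    by move=> e; rewrite !mem_filter => /andP [/sub -> ->].
  move=> ss; have [] // := uniq_min_size (filter_uniq _ (isT : uniq dirs)) ss; first by rewrite eqs.
  move=> _ mE.
  have : d \in [seq e <- dirs | used h w e].
    by rewrite mE mem_filter dd used_rcons // -/w !eqxx orbT.
  by rewrite mem_filter => /andP[].
Qed.

(** * Limiting return probabilities of the greedy walk *)

Lemma grw_choices_neq0 g : grw_choices g != [::].
Proof. by rewrite grw_choicesE; case: [seq e <- dirs | _]. Qed.

Lemma grw_avg_const g (a : rat) :
  \sum_(y <- grw_choices g) (size (grw_choices g))%:R^-1 * a = a.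
Proof.
rewrite -mulr_sumr big_const_seq count_predT -Monoid.iteropE /=.
rewrite -/(a *+ size (grw_choices g)) -[a *+ _]mulr_natl mulrA mulVf ?mul1r //.
by rewrite pnatr_eq0 size_eq0 grw_choices_neq0.
Qed.

Lemma ler_grw_avg g (F G : pt -> rat) :
  (forall y, y \in grw_choices g -> F y <= G y) ->
  \sum_(y <- grw_choices g) (size (grw_choices g))%:R^-1 * F y <=
  \sum_(y <- grw_choices g) (size (grw_choices g))%:R^-1 * G y.
Proof.
move=> FG; rewrite !big_seq; apply: ler_sum => y /FG FGy.
by rewrite ler_wpM2l ?invr_ge0.
Qed.

Lemma grw_prob_ge0 T h ev : 0 <= grw_prob T h ev.
Proof.
elim: T h => [|T IH] h /=; first exact: ler0n.
by rewrite sumr_ge0 // => y _; rewrite mulr_ge0 ?invr_ge0.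
Qed.

Lemma grw_prob_le1 T h ev : grw_prob T h ev <= 1.
Proof.
elim: T h => [|T IH] h /=; first by case: (ev h).
by rewrite -[X in _ <= X](grw_avg_const h) ler_grw_avg.
Qed.

Lemma at_least_returns_rcons N h y :
  at_least_returns N h -> at_least_returns N (rcons h y).
Proof.
move/leq_trans; apply; case: h => [|x h] //=.
by rewrite -cats1 count_cat leq_addr.
Qed.

Lemma grw_prob_attained N T h :
  at_least_returns N h -> grw_prob T h (at_least_returns N) = 1.
Proof.
elim: T h => [|T IH] h hN /=; first by rewrite hN.
rewrite -[RHS](grw_avg_const h); apply: eq_bigr => y _.
by rewrite IH // at_least_returns_rcons.
Qed.

(** The lower limit in [T] of the probability of [N] returns, given the history [h], is at least
    [a]; no limit has to exist among the rationals. *)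
Definition attains (N : nat) (h : seq pt) (a : rat) : Prop :=
  forall eps, 0 < eps -> exists T0, forall T, (T0 <= T)%N ->
    a - eps < grw_prob T h (at_least_returns N).

Lemma attains0 N h : attains N h 0.
Proof.
move=> eps e0; exists 0%N => T _; apply: lt_le_trans (grw_prob_ge0 _ _ _).
by rewrite sub0r oppr_lt0.
Qed.

Lemma attains1 N h : at_least_returns N h -> attains N h 1.
Proof. by move=> hN eps e0; exists 0%N => T _; rewrite grw_prob_attained // gtrBl. Qed.

Lemma uniform_threshold (A : eqType) (s : seq A) (P : A -> nat -> Prop) :
  (forall y, y \in s -> exists T0, forall T, (T0 <= T)%N -> P y T) ->
  exists T0, forall T, (T0 <= T)%N -> forall y, y \in s -> P y T.
Proof.
elim: s => [|x s IH] h; first by exists 0%N.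
have [|T1 h1] := IH; first by move=> y ys; apply: h; rewrite inE ys orbT.
have [|T2 h2] := h x; first by rewrite inE eqxx.
exists (maxn T1 T2) => T; rewrite geq_max => /andP [T1T T2T] y.
by rewrite inE => /orP [/eqP ->|ys]; [apply: h2 | apply: h1].
Qed.

Lemma attains_step N h (f : pt -> rat) :
  (forall y, y \in grw_choices h -> attains N (rcons h y) (f y)) ->
  attains N h (\sum_(y <- grw_choices h) (size (grw_choices h))%:R^-1 * f y).
Proof.
move=> hf eps e0; have e2 : 0 < eps / 2%:R by rewrite divr_gt0.
have [T0 T0P] := uniform_threshold (fun y yc => hf y yc _ e2).
exists T0.+1 => -[//|T] TT; have {}T0P := T0P T TT.
apply: lt_le_trans (_ : \sum_(y <- grw_choices h)
    (size (grw_choices h))%:R^-1 * (f y - eps / 2%:R) <= _).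
  under [ltRHS]eq_bigr do rewrite mulrBr.
  by rewrite sumrB grw_avg_const; lra.
by apply: ler_grw_avg => y /T0P /ltW.
Qed.

Lemma attains_const N h a :
  (forall y, y \in grw_choices h -> attains N (rcons h y) a) -> attains N h a.
Proof. by move=> /attains_step; rewrite grw_avg_const. Qed.

Definition origin_count (h : seq pt) : nat := count (pred1 origin) (behead h).

Lemma origin_count_rcons h y : h != [::] ->
  origin_count (rcons h y) = (origin_count h + (y == origin))%N.
Proof. by case: h => // x h _; rewrite /origin_count /= -cats1 count_cat /= addn0. Qed.

(** Strong Markov property at the end of the excursion: paths back at [w] within [T] steps
    contribute [a], the others are bounded below by 0. *)
Lemma attains_excursion N w n k a : 0 <= a ->
  (forall g, balanced g -> last origin g = w -> (n < udeg g w)%N ->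
     (k <= origin_count g)%N -> attains N g a) ->
  forall T g c p d, on_excursion w n g c p d -> (k <= origin_count g)%N ->
    attains N g (a * grw_hit w T g).
Proof.
move=> a0 aP; elim=> [|T IH] g c p d ex kg; have [[g0 gq dd uq] _ _ nd] := ex.
all: rewrite /=; case: eqP => [gw|gw]; first by
  rewrite mulr1; apply: aP => //; apply: on_excursion_end ex _; rewrite -gq.
  by rewrite mulr0; apply: attains0.
rewrite mulr_sumr; under eq_bigr do rewrite mulrCA.
apply: attains_step => y yc.
have qw : padd p d != w by rewrite -gq; apply/eqP.
have [c' [p' [d' ex']]] := on_excursion_next ex qw yc.
apply: IH ex' _; rewrite origin_count_rcons //; exact: leq_trans (leq_addr _ _).
Qed.

(** Only a return to the vertex is asked for, in any direction, which is how a greedy excursion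
    ends. *)
Definition mirror_excursions_return : Prop :=
  forall w d, d \in dirs ->
    conv_to_one (fun T => mirror_hit w T no_mirror_seen (w, d)).

Lemma mirror_hitS w T c s : mirror_hit w T c s <= mirror_hit w T.+1 c s.
Proof.
elim: T c s => [|T IH] c s; first by case/andP: (mirror_hit_ge0_le1 w 1 c s).
rewrite [leLHS]/= [leRHS]/=; case: ifP => // _; case: (c _) => [m|]; first exact: IH.
by rewrite ler_wpM2l // ler_sum // => m _; apply: IH.
Qed.

Lemma excursion_returns h d : mirror_excursions_return ->
  balanced h -> d \in dirs -> ~~ used h (last origin h) d ->
  forall eps, 0 < eps ->
    exists T, 1 - eps < grw_hit (last origin h) T (rcons h (padd (last origin h) d)).
Proof.
move=> ret hb dd nu eps e0.
have [c ex cN'] := excursion_start hb dd nu.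
have cN v : v \notin h -> c v = None.
  by move=> vh; apply: cN'; apply: contraNN vh => /hasP [e _ /used_mem].
(* Mirrors are prescribed only at vertices of [h], so conditioning multiplies the probability of
   missing by at most [3 ^ size h]. *)
have e1 : 0 < eps / 3%:R ^+ size h by rewrite divr_gt0 // exprn_gt0.
have [T /(_ T (leqnn T)) hT] := ret (last origin h) d dd _ e1; exists T.
rewrite (grw_hit_mirror T ex).
apply: lt_le_trans (mirror_hitS _ _ _ _).
have := mirror_hit_condition (last origin h) T (last origin h, d) cN.
move: hT; set x := mirror_hit _ _ no_mirror_seen _; set y := mirror_hit _ _ c _ => hT.
have : 1 - x < eps / 3%:R ^+ size h by lra.
by rewrite ltr_pdivlMr ?exprn_gt0 // mulrC => h1 h2; lra.
Qed.

(** Crossing a used edge again leaves the set of used edges unchanged. *)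
Lemma balanced_reuse h d : balanced h -> d \in dirs -> used h (last origin h) d ->
  balanced (rcons h (padd (last origin h) d)).
Proof.
move=> [h0 ev] dd u; split; first by case: (h).
move=> v; rewrite -(ev v); apply: eq_odd_at => e; rewrite used_rcons //.
have [->|_] := eqVneq v (last origin h).
  rewrite [_ == padd _ d]eq_sym (negbTE (padd_dir_neq _ dd)) orbF /=.
  by have [->|_] := eqVneq e d; rewrite ?u ?orbF.
have [->|_] := eqVneq v (padd _ d); last by rewrite orbF.
by have [->|_] := eqVneq e (popp d); rewrite ?used_opp ?u ?orbF.
Qed.

(* Removing the finite excursions from the greedy walk leaves a simple random
   walk, whose visits to the origin are visits of the greedy walk. *)
Lemma attains_srw N k h n : mirror_excursions_return -> balanced h ->
  (N <= n + origin_count h)%N -> attains N h (srw_visits k n (last origin h)).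
Proof.
move=> ret; elim: k h n => [|k IHk] h n hb nN.
  case: n nN => [|n] nN; last exact: attains0.
  by apply: attains1.
have [m] := ubnP (4 - udeg h (last origin h)).
elim: m h hb nN => // m IHm h hb nN; rewrite ltnS => dm.
set w := last origin h in dm *.
have [h0 _] := hb.
case E : [seq e <- dirs | ~~ used h w e] => [|e0 s].
  (* All four edges are used, so the greedy walk makes a uniform step: a step of the simple random
     walk. *)
  have chE : grw_choices h = nbrs w by rewrite grw_choicesE -/w E.
  rewrite /= mulr_sumr -[X in attains _ _ X]/(\sum_(y <- nbrs w)
     (size (nbrs w))%:R^-1 * srw_visits k (n - (y == origin)) y) -chE.
  apply: attains_step => y; rewrite chE => /mapP [e ed ->].
  have ue : used h w e.
    case: (boolP (used h w e)) => // nu.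
    have : e \in [seq e <- dirs | ~~ used h w e] by rewrite mem_filter ed andbT.
    by rewrite E.
  have := IHk (rcons h (padd w e)) (n - (padd w e == origin))%N.
  rewrite last_rcons; apply; first exact: balanced_reuse.
  by rewrite origin_count_rcons //; lia.
set a := srw_visits _ _ _.
have a0 : 0 <= a by apply: srw_visits_ge0.
apply: attains_const => y; rewrite grw_choicesE -/w E -E => /mapP [e].
rewrite mem_filter => /andP [nu ed] ->.
have [c ex _] := excursion_start hb ed nu; rewrite -/w in ex.
have aP T : attains N (rcons h (padd w e)) (a * grw_hit w T (rcons h (padd w e))).
  apply: (@attains_excursion N w (udeg h w) (origin_count h)) ex _ => //; last first.
    by rewrite origin_count_rcons // leq_addr.
  move=> g gb gw dg cg; rewrite /a -gw; apply: IHm => //; last first.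
    by have : (udeg g w <= 4)%N := count_size _ dirs; rewrite gw; lia.
  by apply: leq_trans nN _; rewrite leq_add2l.
have a1 : 0 < a + 1 by lra.
(* Dividing by [a + 1] rather than [a] also covers [a = 0]; the incomplete excursions then cost at
   most [eps / 2]. *)
move=> eps e1; have e2 : 0 < eps / (2%:R * (a + 1)) by rewrite divr_gt0 ?mulr_gt0.
have e3 : 0 < eps / 2%:R by rewrite divr_gt0.
have [T hT] := excursion_returns ret hb ed nu e2; rewrite -/w in hT.
have [T0 T0P] := aP T _ e3; exists T0 => T' /T0P; apply: le_lt_trans.
set x := grw_hit _ _ _ in hT *.
have h1 : a * (1 - eps / (2%:R * (a + 1))) <= a * x by rewrite ler_wpM2l // ltW.
have h2 : a * (eps / (2%:R * (a + 1))) <= eps / 2%:R.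
  by rewrite mulrA ler_pdivrMr ?mulr_gt0 //; lra.
by rewrite mulrBr mulr1 in h1; lra.
Qed.

(** * The two implications *)

Lemma balanced_start : balanced [:: origin].
Proof. by split=> // v; apply: (@eq_odd_at _ xpred0). Qed.

Lemma grw_recurrent : mirror_excursions_return ->
  forall N, conv_to_one (grw_ret_prob N).
Proof.
move=> ret N eps e0; have e2 : 0 < eps / 2%:R by rewrite divr_gt0.
have [k hk] := polya_srw_visits N e2.
have NN : (N <= N + origin_count [:: origin])%N by rewrite leq_addr.
have [T0 T0P] := attains_srw k ret balanced_start NN e2.
exists T0 => T /T0P; apply: lt_trans; rewrite /=; lra.
Qed.

(** As long as the origin has not been revisited, making one return requires hitting it. *)
Lemma grw_prob1_le_hit T h y : h != [::] -> origin_count h = 0%N ->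
  grw_prob T (rcons h y) (at_least_returns 1) <= grw_hit origin T (rcons h y).
Proof.
elim: T h y => [|T IH] h y h0 ch; rewrite [leRHS]/= last_rcons.
  case: eqP => [_|/eqP yo]; first exact: grw_prob_le1.
  have c0 : origin_count (rcons h y) = 0%N.
    by rewrite origin_count_rcons // ch (negbTE yo).
  by rewrite /= /at_least_returns -/(origin_count _) c0.
case: eqP => [_|/eqP yo]; first exact: grw_prob_le1.
apply: ler_grw_avg => z _; apply: IH; first by case: (h).
by rewrite origin_count_rcons // ch (negbTE yo).
Qed.

(** The first step is uniform among four directions, so failure in one direction is at most four
    times the overall failure. No edge is used at the start, so the first excursion sees only fresh
    mirrors. *)
Lemma mirror_hit_ge_grw d T : d \in dirs ->
  1 - mirror_hit origin T.+1 no_mirror_seen (origin, d) <=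
  4%:R * (1 - grw_ret_prob 1 T.+1).
Proof.
move=> dd.
pose q e := grw_prob T [:: origin; padd origin e] (at_least_returns 1).
have qle e : e \in dirs -> q e <= mirror_hit origin T.+1 no_mirror_seen (origin, e).
  move=> ed; apply: le_trans (@grw_prob1_le_hit T [:: origin] _ _ _) _ => //.
  have [c ex cN] := excursion_start balanced_start ed (isT : ~~ used [:: origin] _ e).
  rewrite (grw_hit_mirror T ex) (@eq_mirror_hit _ _ c no_mirror_seen) // => v.
  exact: cN.
have -> : grw_ret_prob 1 T.+1 = 4%:R^-1 * \sum_(e <- dirs) q e.
  have chE : grw_choices [:: origin] = nbrs origin by [].
  by rewrite /grw_ret_prob -[LHS]/(\sum_(y <- _) _) chE big_map mulr_sumr.
have q1 e : q e <= 1 by apply: grw_prob_le1.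
apply: le_trans (_ : 1 - q d <= _); first by rewrite lerD2l lerN2 qle.
rewrite mulrBr mulr1 mulVKf //.
have -> : 4%:R - \sum_(e <- dirs) q e = \sum_(e <- dirs) (1 - q e).
  by rewrite sumrB big_const_seq count_predT.
by rewrite (big_rem d) //= lerDl sumr_ge0 // => e _; rewrite subr_ge0.
Qed.

Theorem mainTheorem15 :
  (forall N : nat, conv_to_one (grw_ret_prob N)) <->
  (forall (v d : pt), d \in dirs -> conv_to_one (mirror_ret_prob v d)).
Proof.
split=> [rec v d dd | per]; last first.
  apply: grw_recurrent => w d dd eps e0; have [T0 T0P] := per w d dd eps e0.
  exists T0 => T /T0P /lt_le_trans; apply; exact: mirror_ret_prob_le_hit.
(* Four directions, each losing less than [4 * eps / 17], lose less than [eps] in total. One return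
   of the greedy walk suffices, and the factor 4 in the horizon allows for the four further passages
   through [v]. *)
move=> eps e0; have e1 : 0 < eps / 17%:R by rewrite divr_gt0.
have [T0 T0P] := rec 1%N _ e1; exists (4 * T0.+1)%N => B BT.
rewrite mirror_ret_prob_translate; apply: lt_le_trans (mirror_ret_prob_ge origin dd BT).
rewrite ltrD2l ltrN2; apply: le_lt_trans (_ : \sum_(e <- dirs) (4%:R * (eps / 17%:R)) < _).
  rewrite !big_seq; apply: ler_sum => e ed.
  apply: le_trans (mirror_hit_ge_grw T0 ed) _; rewrite ler_wpM2l //.
  by have := T0P T0.+1 (leqnSn T0); lra.
by rewrite /dirs !big_cons big_nil; lra.
Qed.
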